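(* Let $n, k$ be positive integers. Then there exists some prime $p > k$ such that for any $\alpha^p = (\alpha_1^p,\dots,\alpha_n^p) \in \mathbb{F}_p^n$ there exists some $r \in \mathbb{F}_p^*$ such that $$|r\alpha_i^p|_p \le \left\lfloor \frac{p-1}{k}\right\rfloor \quad\text{for all } i\in\{1,\dots,n\}.$$
   Context: For $x \in \mathbb{F}_p$, let $i(x)\in\{0,1,\dots,p-1\}$ be its standard integer representative. The absolute value of $x$ is $|x|_p := \min\{i(x),\, p - i(x)\}$. *)

(* Defs.v *)
From HB Require Import structures.
From mathcomp Require Import all_boot all_order all_algebra.
Set Implicit Arguments.
Unset Strict Implicit.
Unset Printing Implicit Defensive.

(* The coercion 'F_p >-> nat is the standard representative i(x); it lies in
   {0, ..., p - 1} when p is prime, the only case in which 'F_p is F_p. *)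
Definition absFp (p : nat) (x : 'F_p) : nat := minn x (p - x).
Arguments absFp p x%_ring_scope : clear implicits.

(* Main.v *)
(* Dirichlet's pigeonhole argument: with q = (p - 1) / k, cut {0, ..., p - 1}
   into at most k blocks of q + 1 consecutive integers. If p > k ^ n, then two
   of the p multiples s * alpha have all their coordinates in the same blocks,
   and the difference of the two multipliers is the required r. *)
Require Import Defs.
From mathcomp Require Import all_boot all_order all_algebra.
Set Implicit Arguments.
Unset Strict Implicit.
Unset Printing Implicit Defensive.
Import GRing.Theory.
Local Open Scope ring_scope.

Lemma ltn_Fp (p : nat) (x : 'F_p) : prime p -> (x < p)%N.
Proof. by move=> p_pr; rewrite -[X in (_ < X)%N](Fp_cast p_pr) ltn_ord. Qed.

Lemma absFp_nat_le (p m : nat) : prime p -> (absFp p m%:R <= m)%N.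
Proof.
move=> p_pr; rewrite /absFp (leq_trans (geq_minl _ _)) //.
by rewrite val_Fp_nat // leq_mod.
Qed.

Lemma absFpN (p : nat) (x : 'F_p) : prime p -> absFp p (- x) = absFp p x.
Proof.
(* Zero is apart: [p - x] is the standard representative of [- x] only for nonzero [x], and then the
   arguments of [minn] just swap. *)
move=> p_pr; have [->|x_neq0] := eqVneq x 0; first by rewrite oppr0.
have x_gt0 : (0 < x)%N by rewrite lt0n.
have x_le : (x <= p)%N := ltnW (ltn_Fp x p_pr).
have -> : - x = (p - x)%:R :> 'F_p by rewrite natrB // natr_Zp pchar_Fp_0 // sub0r.
rewrite /absFp val_Fp_nat // modn_small; last by rewrite ltn_subrL x_gt0 prime_gt0.
by rewrite subKn // minnC.
Qed.

(** Two integers in one block of length [q.+1] differ by at most [q], and up to sign, which [absFp]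
    ignores, this difference represents [x - y]. *)
Lemma absFpB_same_block (p q : nat) (x y : 'F_p) :
  prime p -> (x %/ q.+1 = y %/ q.+1)%N -> (absFp p (x - y) <= q)%N.
Proof.
move=> p_pr; wlog le_yx : x y / (y <= x)%N => [th|] eq_xy.
  have [/th|/ltnW /th] := leqP y x; first exact.
  by rewrite -absFpN // opprB; apply.
rewrite -[x in x - _]natr_Zp -[y in _ - y]natr_Zp -natrB //.
apply: leq_trans (absFp_nat_le _ p_pr) _.
rewrite leq_subLR -ltnS -addnS (divn_eq x q.+1) eq_xy.
rewrite [X in (_ < X + _)%N](divn_eq y q.+1) -addnA ltn_add2l.
by rewrite (leq_trans (ltn_pmod _ _)) // leq_addl.
Qed.

Theorem theorem3p6 (n k : nat) (hn : (0 < n)%N) (hk : (0 < k)%N) :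
  exists p : nat,
    [/\ prime p, (k < p)%N
      & forall alpha : 'rV['F_p]_n,
          exists2 r : 'F_p, r != 0
            & forall i : 'I_n,
                (absFp p (r * alpha ord0 i) <= (p - 1) %/ k)%N].
Proof.
have [p lt_kn_p p_pr] := prime_above (k ^ n).
exists p; split=> // [|alpha].
  (* Since [n] is positive, [k <= k ^ n < p]. *)
  by apply: leq_ltn_trans lt_kn_p; rewrite -(prednK hn) expnS leq_pmulr // expn_gt0 hk.
set q := ((p - 1) %/ k)%N.
have block_lt (x : 'F_p) : (x %/ q.+1 < k)%N.
  (* The quotient [q] is rounded down, so [p - 1 < q.+1 * k]: the [k] blocks cover every
     representative. *)
  rewrite ltn_divLR // mulnC (leq_ltn_trans _ (ltn_ceil (p - 1) hk)) //.
  by rewrite subn1 -ltnS prednK ?prime_gt0 // ltn_Fp.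
pose blocks (s : 'F_p) : {ffun 'I_n -> 'I_k} :=
  [ffun i => Ordinal (block_lt (s * alpha ord0 i))].
have /injectivePn[s [t neq_st eq_st]] : ~~ injectiveb blocks.
  apply/injectiveP => /leq_card.
  by rewrite card_ffun !card_ord Fp_cast // leqNgt lt_kn_p.
exists (s - t); first by rewrite subr_eq0.
move=> i; rewrite mulrBl; apply: absFpB_same_block => //.
by move/ffunP/(_ i): eq_st; rewrite !ffunE => -[].
Qed.
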